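(* Let $\kappa$ be an algebraically closed field with $\operatorname{char}(\kappa)\neq 2$. Suppose $G$ is a symplectic group $\mathrm{Sp}_{2n}(\kappa)$ or an orthogonal group $\mathrm{O}_n(\kappa)$, let $\mathfrak{n}$ be the set of nilpotent elements of its Lie algebra, with $G$ acting by conjugation, and let $y\in\mathfrak{n}$ be a distinguished nilpotent element. Then it is impossible to find $x\in\mathfrak{n}$ and a cocharacter $\lambda$ of $G$ with $\lim_\lambda x=y$.
   Context: $\mathrm{Sp}_{2n}(\kappa)$ is the group of $g\in\mathrm{GL}_{2n}(\kappa)$ with $g^\top\Omega_S g=\Omega_S$, where $\Omega_S$ is the matrix with columns $(-e_{2n},\ldots,-e_{n+1},e_n,\ldots,e_1)$; its Lie algebra consists of the matrices $x$ with $x^\top\Omega_S+\Omega_S x=0$. $\mathrm{O}_n(\kappa)$ is the group of $g\in\mathrm{GL}_n(\kappa)$ with $g^\top\Omega_O g=\Omega_O$, where $\Omega_O$ has columns $(e_n,\ldots,e_1)$; its Lie algebra consists of the matrices $x$ with $x^\top\Omega_O+\Omega_O x=0$. A nilpotent element $y$ is distinguished if every torus contained in the stabilizer $C_G(y)=\{g\in G\mid g\cdot y=y\}$ is contained in the center of $G$. (In the symplectic case this holds iff the Jordan block sizes of $y$ are distinct even numbers; in the orthogonal case, iff they are distinct odd numbers.) A cocharacter of $G$ is a homomorphism of algebraic groups $\lambda:\mathbb{G}_m\to G$. We say $\lim_\lambda x=\lim_{a\to0}\lambda(a)\cdot x$ exists if the morphism $\mathbb{G}_m\to\mathfrak{n}$,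 $a\mapsto\lambda(a)\cdot x$, extends to a morphism $\mathbb{A}^1\to\mathfrak{n}$; the limit is then the image of $0$. Writing $\lim_\lambda x=y$ means that the limit exists and equals $y$.
   Formalization: Taken literally the claim fails for x = y with λ the trivial cocharacter, since then lim_λ x = y always holds; the formal statement excludes exactly this pair (x = y and λ trivial) and nothing else. *)

(* Defs.v *)
From mathcomp Require Import all_boot all_order all_algebra.
From mathcomp Require Export mpoly.

Set Implicit Arguments.
Unset Strict Implicit.
Unset Printing Implicit Defensive.

Import GRing.Theory.
Local Open Scope ring_scope.

(* Algebraic groups over the algebraically closed field k are identified with
   their groups of k-points inside GL_m(k), and morphisms with the maps on
   points given by regular functions. *)

Section Forms.
Variable k : closedFieldType.

(* Columns (-e_{2n}, ..., -e_{n+1}, e_n, ..., e_1): column j, counted from 0,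
   is -e or +e of the reversed index according to j < n. *)
Definition Omega_S (n : nat) : 'M[k]_(2 * n) :=
  \matrix_(i, j) (if i == rev_ord j then (if (j < n)%N then -1 else 1) else 0).

Definition Omega_O (n : nat) : 'M[k]_n :=
  \matrix_(i, j) (if i == rev_ord j then 1 else 0).

Inductive classical_form : forall m : nat, 'M[k]_m -> Prop :=
| SymplecticForm n : classical_form (Omega_S n)
| OrthogonalForm n : classical_form (Omega_O n).

End Forms.

Section Groups.
Variables (k : closedFieldType) (m : nat).
Implicit Types (Omega g h x y : 'M[k]_m) (T : 'M[k]_m -> Prop).

Definition in_group Omega g : Prop :=
  g \in unitmx /\ g^T *m Omega *m g = Omega.

Definition in_center Omega g : Prop :=
  in_group Omega g /\ forall h, in_group Omega h -> g *m h = h *m g.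

Definition in_lie Omega x : Prop := x^T *m Omega + Omega *m x = 0.

Definition in_nilcone Omega x : Prop :=
  in_lie Omega x /\ exists d : nat, x ^+ d = 0.

Definition act g x : 'M[k]_m := g *m x *m invmx g.

Definition in_stabilizer Omega y g : Prop := in_group Omega g /\ act g y = y.

Definition entries g : 'I_(m * m) -> k := fun i => mxvec g 0 i.

(* The coordinate ring of GL_m is k[x_ij][1/det]. *)
Definition regular_GL (f : 'M[k]_m -> k) : Prop :=
  exists (p : {mpoly k[m * m]}) (d : nat),
    forall g, g \in unitmx -> f g = p.@[entries g] / (\det g) ^+ d.

Definition closed_in_GL T : Prop :=
  (forall g, T g -> g \in unitmx) /\
  exists S : {mpoly k[m * m]} -> Prop,
    forall g, g \in unitmx -> (T g <-> forall p, S p -> p.@[entries g] = 0).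

Definition in_Gm (r : nat) (t : 'I_r -> k) : Prop := forall i, t i != 0.

(* The coordinate ring of (G_m)^r is the ring of Laurent polynomials. *)
Definition regular_Gm (r : nat) (f : ('I_r -> k) -> k) : Prop :=
  exists (p : {mpoly k[r]}) (d : nat),
    forall t, in_Gm t -> f t = p.@[t] / (\prod_(i < r) t i) ^+ d.

(* T is a closed subgroup of GL_m isomorphic to (G_m)^r as an algebraic group:
   phi is the isomorphism and psi its inverse. As T is closed in the affine
   variety GL_m, the regular functions on T are the restrictions of those on
   GL_m. *)
Definition is_torus T : Prop :=
  closed_in_GL T /\
  exists (r : nat) (phi : ('I_r -> k) -> 'M[k]_m) (psi : 'M[k]_m -> 'I_r -> k),
    [/\ forall i j, regular_Gm (fun t => phi t i j),
        forall i, regular_GL (fun g => psi g i),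
        forall s t, in_Gm s -> in_Gm t ->
          phi (fun i => s i * t i) = phi s *m phi t,
        forall t, in_Gm t -> forall i, psi (phi t) i = t i
      & forall g, T g <-> exists2 t, in_Gm t & g = phi t].

Definition distinguished Omega y : Prop :=
  forall T, is_torus T ->
    (forall g, T g -> in_stabilizer Omega y g) ->
    forall g, T g -> in_center Omega g.

(* The value of lam at 0 is irrelevant here and below. *)
Definition cocharacter Omega (lam : k -> 'M[k]_m) : Prop :=
  [/\ forall a, a != 0 -> in_group Omega (lam a),
      forall a b, a != 0 -> b != 0 -> lam (a * b) = lam a *m lam b
    & exists (P : 'M[{poly k}]_m) (d : nat),
        forall a, a != 0 -> forall i j, lam a i j = (P i j).[a] / a ^+ d].

Definition trivial_cocharacter (lam : k -> 'M[k]_m) : Prop :=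
  forall a, a != 0 -> lam a = 1%:M.

(* A morphism from the affine line to the nilpotent cone is a matrix Q of
   polynomials all of whose values lie in the cone. *)
Definition has_limit Omega (lam : k -> 'M[k]_m) x y : Prop :=
  exists Q : 'M[{poly k}]_m,
    [/\ forall a, in_nilcone Omega (map_mx (horner_eval a) Q),
        forall a, a != 0 -> act (lam a) x = map_mx (horner_eval a) Q
      & map_mx (horner_eval 0) Q = y].

End Groups.

(* Main.v *)
(* The limit y is fixed by lam, so all weight projections A_l of lam (the
   coefficients of its Laurent expansion, which are orthogonal idempotents)
   commute with y, and the form pairs weight l with weight -l only.  If some
   weight is nonzero, with E its projection and F that of the opposite weight,
   then t |-> t E + t^-1 F + (1 - E - F) is an embedded one-dimensional torus in
   the stabilizer of y, which spares the quotient of G_m by the kernel of lam.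
   It is not central: for v in im E and w in im F that are not orthogonal, the
   reflection or transvection along v + w does not commute with it.  Hence lam
   is trivial, and then x = y. *)
Require Import Defs.
From mathcomp Require Import all_boot all_order all_algebra zify ring.

Set Implicit Arguments.
Unset Strict Implicit.
Unset Printing Implicit Defensive.

Import GRing.Theory.
Local Open Scope ring_scope.

(** * Polynomial identities on the punctured line *)

Lemma poly_eq0_unit_points (k : closedFieldType) (p : {poly k}) :
  (forall a, a != 0 -> p.[a] = 0) -> p = 0.
Proof.
move=> p0; apply/eqP; apply: contraT => pn0.
have /closed_nonrootP[a] : p * 'X != 0 by rewrite mulf_neq0 ?polyX_eq0.
rewrite rootM rootX negb_or => /andP[+ an0].
by rewrite /root p0 ?eqxx.
Qed.

(** Entrywise this is a polynomial vanishing off 0. It is the tool for comparing coefficients, so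
    that an identity in [lam a] splits into one identity per weight. *)
Lemma mx_coef_eq0 (k : closedFieldType) (m n N : nat)
    (C : 'I_N -> 'M[k]_(m, n)) :
  (forall a, a != 0 -> \sum_(l < N) a ^+ l *: C l = 0) -> forall l, C l = 0.
Proof.
move=> C0 l; apply/matrixP => i j; rewrite mxE.
(* [\poly] wants coefficients indexed by all naturals; the value 0 beyond [N] is never read. *)
pose c e := if insub e is Some e' then C e' i j else 0.
have cE (e : 'I_N) : c e = C e i j by rewrite /c valK.
pose p := \poly_(e < N) c e.
have : p = 0.
  apply: poly_eq0_unit_points => a /C0/matrixP/(_ i j).
  rewrite summxE mxE horner_poly; apply: etrans.
  by apply: eq_bigr => e _; rewrite !mxE cE mulrC.
move/polyP/(_ l); rewrite coef_poly ltn_ord coef0 => <-.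
by rewrite cE.
Qed.

Lemma exists_expr_neq (k : closedFieldType) (e f : nat) :
  e != f -> exists2 a : k, a != 0 & a ^+ e != a ^+ f.
Proof.
move=> ef; have /closed_nonrootP[a] : ('X^e - 'X^f) * 'X != 0 :> {poly k}.
  rewrite mulf_neq0 ?polyX_eq0 // subr_eq0.
  apply: contraNneq ef => /polyP/(_ e).
  by rewrite !coefXn eqxx; case: eqVneq => // _ /eqP; rewrite oner_eq0.
rewrite rootM rootX negb_or => /andP[+ an0]; exists a => //; move: a0.
by rewrite /root hornerD hornerN !hornerXn subr_eq0.
Qed.

(** * Weight decomposition of a cocharacter *)

Section Weights.
Variables (k : closedFieldType) (m : nat) (Omega : 'M[k]_m).
Variable lam : k -> 'M[k]_m.
Hypothesis lam_cochar : cocharacter Omega lam.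

(** The index [l] stands for the weight [l - d], which keeps all exponents natural. The relations
    come from [lam (a * b) = lam a *m lam b] by comparing coefficients, first in one variable and
    then in the other. *)
Lemma cocharacter_weights :
  exists (N d : nat) (A : 'I_N -> 'M[k]_m),
    [/\ forall a, a != 0 -> lam a = \sum_(l < N) (a ^+ l / a ^+ d) *: A l,
        forall l a, a != 0 -> lam a *m A l = (a ^+ l / a ^+ d) *: A l,
        forall l l', A l *m A l' = if l == l' then A l else 0
      & \sum_l A l = 1%:M].
Proof.
case: lam_cochar => lamG lamM [P [d lamP]].
pose N := \max_i \max_j size (P i j).
pose A (l : 'I_N) := \matrix_(i, j) (P i j)`_l.
have lamA a : a != 0 -> lam a = \sum_(l < N) (a ^+ l / a ^+ d) *: A l.
  move=> a0; apply/matrixP => i j; rewrite lamP // summxE.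
  rewrite (@horner_coef_wide _ N); last first.
    by rewrite /N; apply: (bigmax_sup i) => //; apply: (bigmax_sup j).
  by rewrite mulr_suml; apply: eq_bigr => l _; rewrite !mxE -mulrA mulrC.
have lamA' a : a != 0 -> a ^+ d *: lam a = \sum_(l < N) a ^+ l *: A l.
  move=> a0; rewrite lamA // scaler_sumr; apply: eq_bigr => l _.
  by rewrite scalerA mulrC divfK // expf_neq0.
(* With [b] fixed, both sides are the coefficients of [a ^+ l] in [a ^+ d *: lam (a * b)]. *)
have Alam l b : b != 0 -> A l *m lam b = (b ^+ l / b ^+ d) *: A l.
  move=> b0; apply/eqP; rewrite -subr_eq0; apply/eqP; move: l.
  apply: mx_coef_eq0 => a a0.
  have bd0 : b ^+ d != 0 by rewrite expf_neq0.
  under eq_bigr do rewrite scalerBr scalemxAl.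
  rewrite sumrB -mulmx_suml -lamA' // -scalemxAl -lamM //.
  apply/eqP; rewrite subr_eq0; apply/eqP.
  rewrite lamA ?mulf_neq0 // scaler_sumr; apply: eq_bigr => l _.
  rewrite !scalerA !exprMn; congr (_ *: _).
  by field; rewrite ?mulf_neq0 ?expf_neq0.
have lamAr l b : b != 0 -> lam b *m A l = (b ^+ l / b ^+ d) *: A l.
  move=> b0; apply/eqP; rewrite -subr_eq0; apply/eqP; move: l.
  apply: mx_coef_eq0 => a a0.
  have bd0 : b ^+ d != 0 by rewrite expf_neq0.
  under eq_bigr do rewrite scalerBr scalemxAr.
  rewrite sumrB -mulmx_sumr -lamA' // -scalemxAr -lamM //.
  apply/eqP; rewrite subr_eq0; apply/eqP.
  rewrite lamA ?mulf_neq0 // scaler_sumr; apply: eq_bigr => l _.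
  rewrite !scalerA !exprMn; congr (_ *: _).
  by field; rewrite ?mulf_neq0 ?expf_neq0.
exists N, d, A; split=> //.
  (* Now the coefficients of powers of [b] in [A l *m lam b] are compared. *)
  move=> l l'; apply/eqP; rewrite -subr_eq0; apply/eqP; move: l'.
  apply: mx_coef_eq0 => b b0.
  under eq_bigr do rewrite scalerBr scalemxAr.
  rewrite sumrB -mulmx_sumr -lamA' // -scalemxAr Alam // scalerA.
  rewrite (bigD1 l) //= eqxx big1 => [|l' /negPf nl]; last first.
    by rewrite eq_sym nl scaler0.
  by rewrite addr0 mulrC divfK ?expf_neq0 // subrr.
(* The projections sum to [lam 1], an invertible idempotent, hence the identity. *)
have [l1u _] := lamG 1 (oner_neq0 _).
have : lam 1 = 1%:M.
  have := lamM 1 1 (oner_neq0 _) (oner_neq0 _).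
  rewrite mulr1 => /(congr1 (mulmx (invmx (lam 1)))).
  by rewrite mulmxA mulVmx // mul1mx.
rewrite lamA ?oner_neq0 // => <-.
by apply: eq_bigr => l _; rewrite !expr1n divr1 scale1r.
Qed.

End Weights.

(** * Columns of products and the generic matrix *)

Lemma col_mul (R : pzSemiRingType) (m n p : nat) (j : 'I_p)
    (A : 'M[R]_(m, n)) (B : 'M[R]_(n, p)) :
  col j (A *m B) = A *m col j B.
Proof. by rewrite !colE mulmxA. Qed.

Section GenericMatrix.
Variables (k : comNzRingType) (m : nat).

(** The matrix of coordinate functions: evaluating an expression in it at the entries of [g] gives
    that expression in [g], which yields the polynomials on GL_m used below. *)
Definition generic_mx : 'M[{mpoly k[m * m]}]_m :=
  \matrix_(i, j) 'X_(mxvec_index i j).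

Lemma meval_generic_mx (g : 'M[k]_m) :
  map_mx (meval (fun i => mxvec g 0 i)) generic_mx = g.
Proof. by apply/matrixP => i j; rewrite !mxE mevalXU mxvecE. Qed.

Lemma meval_mxC n (v : 'I_n -> k) (A : 'M[k]_m) :
  map_mx (meval v) (map_mx (@mpolyC n k) A) = A.
Proof. by apply/matrixP => i j; rewrite !mxE mevalC. Qed.

Lemma meval_entry n (v : 'I_n -> k) (X : 'M[{mpoly k[n]}]_m) i j :
  (X i j).@[v] = (map_mx (meval v) X) i j.
Proof. by rewrite mxE. Qed.

End GenericMatrix.

(** * Reflections and transvections preserving the form *)

Section Reflection.
Variables (k : closedFieldType) (m : nat) (Omega : 'M[k]_m) (eps : k).
Hypotheses (Omega_unit : Omega \in unitmx) (OmegaT : Omega^T = eps *: Omega).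

(* [c = -2 / q] makes this the reflection in an anisotropic vector [u]; when
   [Omega] is alternating [q = 0] and this is a transvection. *)
Lemma reflection_group (u : 'cV[k]_m) (c q : k) :
  u^T *m Omega *m u = q%:M -> eps * c + c + eps * c ^+ 2 * q = 0 ->
  in_group Omega (1%:M + c *: (u *m u^T *m Omega)).
Proof.
move=> uq cq; set h := 1%:M + _.
suff hO : h^T *m Omega *m h = Omega.
  split=> //; have : invmx Omega *m h^T *m Omega *m h = 1%:M.
    by rewrite -mulmxA -mulmxA [h^T *m _]mulmxA hO mulVmx.
  by case/mulmx1_unit.
pose M := Omega *m (u *m u^T *m Omega).
have hT : h^T = 1%:M + (eps * c) *: (Omega *m (u *m u^T)).
  rewrite linearD linearZ /= trmx1 !trmx_mul trmxK OmegaT.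
  by rewrite -scalemxAl scalerA mulrC.
have OuO : Omega *m (u *m u^T) *m Omega = M by rewrite /M !mulmxA.
have MuO : M *m (u *m u^T *m Omega) = q *: M.
  rewrite /M -!mulmxA [u^T *m (Omega *m _)]mulmxA.
  rewrite [u^T *m Omega *m (u *m _)]mulmxA uq.
  by rewrite mul_scalar_mx -!scalemxAr.
(* The product expands to [Omega] plus [eps * c + c + eps * c ^+ 2 * q] times [M]. *)
rewrite hT mulmxDl mul1mx -scalemxAl OuO mulmxDl !mulmxDr !mulmx1.
rewrite -!scalemxAr -!scalemxAl MuO !scalerA -/M.
rewrite -addrA -!scalerDl [X in X *: _](_ : _ = 0) ?scale0r ?addr0 //.
by rewrite -cq; ring.
Qed.

End Reflection.

(** * A one-dimensional torus from three orthogonal idempotents *)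

Section Torus.
Variables (k : closedFieldType) (m : nat) (E F R : 'M[k]_m).
Hypotheses (EE : E *m E = E) (FF : F *m F = F) (RR : R *m R = R).
Hypotheses (EF : E *m F = 0) (FE : F *m E = 0).
Hypotheses (ER : E *m R = 0) (RE : R *m E = 0).
Hypotheses (FR : F *m R = 0) (RF : R *m F = 0).
Hypothesis EFR : E + F + R = 1%:M.
Hypotheses (E0 : E != 0) (F0 : F != 0).

Definition weight_one (t : k) : 'M[k]_m := t *: E + t^-1 *: F + R.

Lemma weight_oneM s t : weight_one (s * t) = weight_one s *m weight_one t.
Proof.
rewrite /weight_one !(mulmxDl, mulmxDr) -!(scalemxAl, scalemxAr).
rewrite EE FF RR EF FE ER RE FR RF !scaler0 !(addr0, add0r).
by rewrite !scalerA invfM.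
Qed.

Lemma weight_one1 : weight_one 1 = 1%:M.
Proof. by rewrite /weight_one invr1 !scale1r. Qed.

Lemma weight_one_unit t : t != 0 -> weight_one t \in unitmx.
Proof.
move=> t0; have := weight_oneM t t^-1.
by rewrite mulfV // weight_one1 => /esym /mulmx1_unit[].
Qed.

Definition weight_one_torus (g : 'M[k]_m) :=
  exists2 t : 'I_1 -> k, in_Gm t & g = weight_one (t ord0).

Lemma weight_one_torusP : is_torus weight_one_torus.
Proof.
have /matrix0Pn[a [b Eab]] := E0; have /matrix0Pn[c [d Fcd]] := F0.
pose X := generic_mx k m.
pose C (Y : 'M[k]_m) := map_mx (@mpolyC (m * m) k) Y.
(* A nonzero entry of [E] reads off the parameter [t] linearly from [weight_one t]; likewise [F]
   gives [t^-1]. *)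
pose pE := (E a b)^-1 *: (C E *m X) a b.
pose pF := (F c d)^-1 *: (C F *m X) c d.
have pEE g : pE.@[entries g] = (E *m g) a b / E a b.
  by rewrite mevalZ meval_entry map_mxM meval_mxC meval_generic_mx mulrC.
have pFE g : pF.@[entries g] = (F *m g) c d / F c d.
  by rewrite mevalZ meval_entry map_mxM meval_mxC meval_generic_mx mulrC.
have pEt t : pE.@[entries (weight_one t)] = t.
  rewrite pEE !mulmxDr -!scalemxAr EE EF ER scaler0 !addr0 mxE.
  by rewrite mulfK.
have pFt t : pF.@[entries (weight_one t)] = t^-1.
  rewrite pFE !mulmxDr -!scalemxAr FF FE FR scaler0 addr0 add0r mxE.
  by rewrite mulfK.
pose Q := X - (pE *: C E + pF *: C F + C R).
have QE g : map_mx (meval (entries g)) Q =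
    g - (pE.@[entries g] *: E + pF.@[entries g] *: F + R).
  by rewrite map_mxB !map_mxD !map_mxZ !meval_mxC meval_generic_mx.
split.
  split=> [g [t t0 ->]|]; first exact: weight_one_unit.
  (* The equations are the whole vanishing ideal of the image. It contains [pE * pF - 1] and the
     entries of [Q], which already force [g] to be [weight_one] at the value of [pE]. *)
  exists (fun p => forall t, t != 0 -> p.@[entries (weight_one t)] = 0).
  move=> g gu; split=> [[t t0 ->] p pS|gS]; first exact: pS.
  have guv : pE.@[entries g] * pF.@[entries g] = 1.
    apply/eqP; rewrite -subr_eq0; apply/eqP.
    have /gS : forall t, t != 0 -> (pE * pF - 1).@[entries (weight_one t)] = 0.
      by move=> t t0; rewrite mevalB mevalM meval1 pEt pFt mulfV ?subrr.
    by rewrite mevalB mevalM meval1.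
  have u0 : pE.@[entries g] != 0.
    by apply: contra_eq_neq guv => ->; rewrite mul0r eq_sym oner_neq0.
  exists (fun=> pE.@[entries g]) => //.
  rewrite /weight_one -[_^-1]mulr1 -guv mulKf //.
  apply/eqP; rewrite -subr_eq0 -QE; apply/eqP/matrixP => i j.
  rewrite -meval_entry [RHS]mxE; apply: gS => t t0.
  by rewrite meval_entry QE pEt pFt subrr mxE.
exists 1%N, (fun t => weight_one (t ord0)), (fun g _ => pE.@[entries g]).
split.
- move=> i j.
  (* Clearing the denominator: the matrix is [t ^+ 2 *: E + F + t *: R] divided by [t]. *)
  exists (E i j *: 'X_ord0 ^+ 2 + (F i j)%:MP + R i j *: 'X_ord0), 1%N => t t0.
  rewrite big_ord1 expr1 !mevalD !mevalZ rmorphXn /= mevalC mevalXU !mxE.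
  by field; apply: t0.
- by move=> i; exists pE, 0%N => g gu; rewrite expr0 divr1.
- by move=> s t _ _; exact: weight_oneM.
- by move=> t t0 i; rewrite pEt (ord1 i).
- by [].
Qed.

(** * The torus and the isometry group of the form *)

Section Form.
Variables (Omega : 'M[k]_m) (eps : k).
Hypotheses (Omega_unit : Omega \in unitmx).
Hypotheses (epsP : eps = 1 \/ eps = -1) (OmegaT : Omega^T = eps *: Omega).
Hypothesis EOE : E^T *m Omega *m E = 0.
Hypothesis FOF : F^T *m Omega *m F = 0.
Hypothesis EOR : E^T *m Omega *m R = 0.
Hypothesis ROE : R^T *m Omega *m E = 0.
Hypothesis FOR : F^T *m Omega *m R = 0.
Hypothesis ROF : R^T *m Omega *m F = 0.
Hypothesis EOF : E^T *m Omega *m F != 0.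

Lemma weight_one_group t : t != 0 -> in_group Omega (weight_one t).
Proof.
(* Only the pairings of [E] with [F] and of [R] with itself survive, and there the powers of [s]
   cancel; the value is therefore the one at [s = 1]. *)
have S s : s != 0 -> (weight_one s)^T *m Omega *m weight_one s =
    E^T *m Omega *m F + F^T *m Omega *m E + R^T *m Omega *m R.
  move=> s0; rewrite /weight_one !linearD !linearZ /=.
  rewrite !(mulmxDl, mulmxDr) -!(scalemxAl, scalemxAr).
  rewrite EOE FOF EOR ROE FOR ROF !scaler0 !(addr0, add0r).
  by rewrite !scalerA mulfV // mulVf // !scale1r [F^T *m _ *m _ + _]addrC.
move=> t0; split; first exact: weight_one_unit.
rewrite S // -(S 1 (oner_neq0 _)) weight_one1.
by rewrite trmx1 mul1mx mulmx1.
Qed.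

Lemma weight_one_not_central :
  ~ forall t, t != 0 -> in_center Omega (weight_one t).
Proof.
move=> ctr; have /matrix0Pn[i [j ij]] := EOF.
pose v := col i E; pose w := col j F; pose u := v + w.
have Ev : E *m v = v by rewrite -col_mul EE.
have Fv : F *m v = 0 by rewrite -col_mul FE col0.
have Rv : R *m v = 0 by rewrite -col_mul RE col0.
have Ew : E *m w = 0 by rewrite -col_mul EF col0.
have Fw : F *m w = w by rewrite -col_mul FF.
have Rw : R *m w = 0 by rewrite -col_mul RF col0.
pose b : k := (E^T *m Omega *m F) i j.
have vOw : v^T *m Omega *m w = b%:M.
  rewrite tr_col -row_mul -col_mul -row_mul [LHS]mx11_scalar.
  by rewrite [col _ _ _ _]mxE [row _ _ _ _]mxE.
have vOv : v^T *m Omega *m v = 0.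
  by rewrite tr_col -row_mul -col_mul -row_mul EOE row0 col0.
have wOw : w^T *m Omega *m w = 0.
  by rewrite tr_col -row_mul -col_mul -row_mul FOF row0 col0.
have wOv : w^T *m Omega *m v = (eps * b)%:M.
  rewrite [LHS]mx11_scalar -tr_scalar_mx -mx11_scalar !trmx_mul trmxK OmegaT.
  by rewrite -scalemxAl -scalemxAr mulmxA vOw scale_scalar_mx.
have uOv : u^T *m Omega *m v = (eps * b)%:M.
  by rewrite linearD !mulmxDl vOv wOv add0r.
have uOu : u^T *m Omega *m u = ((1 + eps) * b)%:M.
  rewrite mulmxDr uOv linearD !mulmxDl vOw wOw addr0 -raddfD /=.
  by rewrite addrC mulrDl mul1r.
have e0 : eps != 0 by case: epsP => ->; rewrite ?oppr_eq0 oner_neq0.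
have b0 : b != 0 by [].
(* For [eps = 1] the vector [u] has [q = 2b], so [c = -2 / q = - b^-1]; for [eps = -1] it has
   [q = 0] and any nonzero [c] works. *)
have [c c0 cq] : exists2 c, c != 0 &
    eps * c + c + eps * c ^+ 2 * ((1 + eps) * b) = 0.
  case: epsP => ->; last by exists 1; rewrite ?oner_neq0 //; ring.
  exists (- b^-1); first by rewrite oppr_eq0 invr_eq0.
  by field.
have hG := reflection_group Omega_unit OmegaT uOu cq; set h := _ + _ in hG.
have [t t0 t2] := exists_expr_neq k (isT : 2 != 0%N).
have [_ /(_ h hG)/(congr1 (mulmx^~ v))] := ctr t t0.
have tv : weight_one t *m v = t *: v.
  by rewrite !mulmxDl -!scalemxAl Ev Fv Rv scaler0 !addr0.
have tw : weight_one t *m w = t^-1 *: w.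
  by rewrite !mulmxDl -!scalemxAl Ew Fw Rw scaler0 add0r addr0.
have hv : h *m v = v + (c * (eps * b)) *: u.
  rewrite mulmxDl mul1mx -scalemxAl -!mulmxA [u^T *m _]mulmxA uOv.
  by rewrite mul_mx_scalar scalerA.
(* Commutation with [h], applied to [v], makes [weight_one t] scale [u] by [t]. Its [w] component
   then gives [t^-1 = t], against [t ^+ 2 != 1]. *)
rewrite -!mulmxA tv hv mulmxDr -!scalemxAr hv mulmxDr tv tw.
rewrite [t *: (v + _)]scalerDr.
move/addrI; rewrite scalerA [t * _]mulrC -(scalerA _ t).
have cb0 : c * (eps * b) != 0 by rewrite !mulf_neq0.
move/(scalerI cb0); rewrite [RHS]scalerDr => /addrI.
move/(congr1 (mulmx (v^T *m Omega))); rewrite -!scalemxAr vOw.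
move/matrixP/(_ 0 0); rewrite !mxE eqxx mulr1n => /(mulIf b0) tt.
by case/eqP: t2; rewrite expr0 expr2 -{1}tt mulVf.
Qed.

End Form.
End Torus.

(** * Nondegeneracy and symmetry of the two forms *)

Lemma classical_form_unit_sym (k : closedFieldType) (m : nat)
    (Omega : 'M[k]_m) :
  classical_form Omega ->
  Omega \in unitmx /\
  exists2 eps, eps = 1 \/ eps = -1 & Omega^T = eps *: Omega.
Proof.
have antidiag_unit n (s : 'I_n -> k) : (forall j, s j * s j = 1) ->
    (\matrix_(i, j) if i == rev_ord j then s j else 0) \in unitmx.
  move=> ss; set M := \matrix_(_, _) _.
  suff : M^T *m M = 1%:M by case/mulmx1_unit.
  apply/matrixP => i j; rewrite !mxE (bigD1 (rev_ord i)) //=.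
  rewrite big1 => [|r /negPf ri].
    rewrite !mxE eqxx (inj_eq rev_ord_inj) addr0.
    by case: eqVneq => [->|_]; rewrite ?ss ?mulr0.
  by rewrite !mxE ri mul0r.
case=> n.
  split; first by apply: antidiag_unit => j; case: ifP; rewrite ?mulrNN mulr1.
  exists (-1); first by right.
  apply/matrixP => i j; rewrite !mxE -(can_eq rev_ordK) rev_ordK eq_sym.
  case: eqVneq => [->|_]; last by rewrite mulr0.
  (* Reversal exchanges the two halves of the indices, hence the two signs. *)
  rewrite [(rev_ord j < n)%N]/=.
  have -> : (2 * n - j.+1 < n)%N = ~~ (j < n)%N.
    by have := ltn_ord j; lia.
  by case: (j < n)%N; rewrite ?mulN1r ?opprK ?mulr1.
split; first by apply: antidiag_unit => j; rewrite mulr1.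
exists 1; first by left.
apply/matrixP => i j; rewrite !mxE mul1r -(can_eq rev_ordK) rev_ordK eq_sym.
by [].
Qed.

(** * Limits along a cocharacter *)

Section Limit.
Variables (k : closedFieldType) (m : nat) (Omega : 'M[k]_m).
Variables (lam : k -> 'M[k]_m) (x y : 'M[k]_m).
Hypothesis lam_cochar : cocharacter Omega lam.
Hypothesis lim_xy : has_limit Omega lam x y.

(** Conjugation by [lam a] takes [Q] at [b] to [Q] at [a * b] for nonzero [b]. This is polynomial in
    [b], so it persists at 0, where both values of [Q] are [y]. *)
Lemma limit_comm a : a != 0 -> lam a *m y = y *m lam a.
Proof.
case: lam_cochar => lamG lamM _; case: lim_xy => Q [_ Qact <-] a0.
have [lau _] := lamG a a0.
have actM b : b != 0 ->
    lam a *m map_mx (horner_eval b) Q = map_mx (horner_eval (a * b)) Q *m lam a.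
  move=> b0; have [lbu _] := lamG b b0.
  rewrite -Qact // -Qact ?mulf_neq0 // /act lamM // -!mulmxA.
  have -> : invmx (lam a *m lam b) = invmx (lam b) *m invmx (lam a).
    have lu : lam a *m lam b \in unitmx by rewrite unitmx_mul lau.
    by apply: (can_inj (mulKmx lu)); rewrite mulmxV // mulmxA mulmxK // mulmxV.
  by rewrite -mulmxA mulVmx // mulmx1.
pose C := map_mx (@polyC k) (lam a).
pose D := C *m Q - map_mx (comp_poly (a%:P * 'X)) Q *m C.
have DE b : map_mx (horner_eval b) D =
    lam a *m map_mx (horner_eval b) Q - map_mx (horner_eval (a * b)) Q *m lam a.
  have CE : map_mx (horner_eval b) C = lam a.
    by apply/matrixP => i j; rewrite !mxE /horner_eval hornerC.
  rewrite map_mxB !map_mxM CE; congr (_ - _ *m _).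
  apply/matrixP => i j; rewrite !mxE /= /horner_eval horner_comp.
  by rewrite hornerM hornerC hornerX.
suff D0 : D = 0.
  have := DE 0; rewrite D0 map_mx0 mulr0 => /esym/eqP.
  by rewrite subr_eq0 => /eqP.
apply/matrixP => i j; rewrite [RHS]mxE; apply: poly_eq0_unit_points => b b0.
have /matrixP/(_ i j) := DE b; rewrite actM // subrr.
by rewrite mxE [RHS]mxE.
Qed.

Lemma limit_trivial : trivial_cocharacter lam -> x = y.
Proof.
case: lim_xy => Q [_ Qact <-] triv.
suff -> : Q = map_mx polyC x.
  by apply/matrixP => i j; rewrite !mxE /horner_eval hornerC.
apply/matrixP => i j; apply/eqP; rewrite -subr_eq0; apply/eqP.
apply: poly_eq0_unit_points => a a0; have /matrixP/(_ i j) := Qact a a0.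
rewrite triv // /act mul1mx invmx1 mulmx1 !mxE hornerD hornerN hornerC => ->.
by rewrite /horner_eval subrr.
Qed.

End Limit.

(* The pair x = y, lam trivial always satisfies lim_lam x = y; it is the only
   one excluded. *)
Theorem corollary2p3 (k : closedFieldType) (hk : 2%N \notin [pchar k])
    (m : nat) (Omega : 'M[k]_m) (hOmega : classical_form Omega)
    (y : 'M[k]_m) (hy : in_nilcone Omega y) (hdist : distinguished Omega y) :
  ~ exists (x : 'M[k]_m) (lam : k -> 'M[k]_m),
      [/\ in_nilcone Omega x,
          cocharacter Omega lam,
          ~ (x = y /\ trivial_cocharacter lam)
        & has_limit Omega lam x y].
Proof.
case=> x [lam [_ lamC nontriv lim]].
have [Ou [eps epsP OT]] := classical_form_unit_sym hOmega.
have [N [d [A [lamA lamAr AA A1]]]] := cocharacter_weights lamC.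
have [lamG _ _] := lamC.
(* Invariance of the form under [lam a] multiplies this pairing by [a ^+ (i + j) / a ^+ (d + d)], so
   it vanishes unless the weights are opposite. *)
have AOA (i j : 'I_N) : (i + j != d + d)%N -> (A i)^T *m Omega *m A j = 0.
  move=> /(exists_expr_neq k)[a a0 aij]; have [_ aO] := lamG a a0.
  have : (lam a *m A i)^T *m Omega *m (lam a *m A j) = (A i)^T *m Omega *m A j.
    by rewrite -{2}aO trmx_mul !mulmxA.
  rewrite !lamAr // !linearZ /= -!scalemxAl scalerA mulrC => /eqP.
  rewrite -subr_eq0 -{2}[_ *m _ *m _]scale1r -scalerBl scaler_eq0.
  case/orP=> [|/eqP //]; rewrite subr_eq0 mulrACA -invfM -!exprD => /eqP aa.
  by case/eqP: aij; rewrite -[RHS]mul1r -aa divfK // expf_neq0.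
have Ay (i : 'I_N) : A i *m y = y *m A i.
  apply/eqP; rewrite -subr_eq0; apply/eqP; move: i; apply: mx_coef_eq0 => a a0.
  under eq_bigr do rewrite scalerBr scalemxAl scalemxAr.
  rewrite sumrB -mulmx_suml -mulmx_sumr.
  have -> : \sum_(i < N) a ^+ i *: A i = a ^+ d *: lam a.
    rewrite lamA // scaler_sumr; apply: eq_bigr => i _.
    by rewrite scalerA mulrC divfK // expf_neq0.
  by rewrite -scalemxAl -scalemxAr (limit_comm lamC lim) // subrr.
(* Index [d] is weight 0: if no other weight occurs, [lam] is trivial and [x = y], the excluded
   case. *)
have [l ld Al] : exists2 l : 'I_N, (l : nat) != d & A l != 0.
  apply/exists_inP; apply: contraT => /exists_inPn A0; case: nontriv.
  have triv : trivial_cocharacter lam.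
    move=> a a0; rewrite lamA // -A1; apply: eq_bigr => l _.
    have [->|/A0] := eqVneq (l : nat) d.
      by rewrite mulfV ?expf_neq0 ?scale1r.
    by rewrite negbK => /eqP ->; rewrite scaler0.
  by split=> //; apply: limit_trivial lim triv.
(* Since the projections sum to 1 and [Omega] is invertible, some weight space pairs nontrivially
   with that of [l]. *)
have [l' All] : exists l' : 'I_N, (A l)^T *m Omega *m A l' != 0.
  apply/existsP; apply: contraT => /existsPn A0; case/eqP: Al.
  have: (A l)^T *m Omega *m \sum_i A i = 0.
    rewrite mulmx_sumr big1 // => i _.
    by apply/eqP; have := A0 i; rewrite negbK.
  rewrite A1 mulmx1 => /(congr1 (mulmxr (invmx Omega))) /=.
  by rewrite mulmxK // mul0mx => /(congr1 trmx); rewrite trmxK trmx0.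
have lld : (l + l' = d + d)%N by apply: contraNeq All => /AOA ->.
have l'l : l' != l.
  apply: contraNneq ld => l'l.
  by move: lld; rewrite l'l !addnn => /double_inj ->.
pose E := A l; pose F := A l'; pose R := \sum_(i | (i != l) && (i != l')) A i.
have EFR : E + F + R = 1%:M by rewrite -A1 (bigD1 l) //= (bigD1 l') //= addrA.
have EE : E *m E = E by rewrite AA eqxx.
have FF : F *m F = F by rewrite AA eqxx.
have EF : E *m F = 0 by rewrite AA eq_sym (negPf l'l).
have FE : F *m E = 0 by rewrite AA (negPf l'l).
have ER : E *m R = 0.
  by rewrite mulmx_sumr big1 // => i /andP[il _]; rewrite AA eq_sym (negPf il).
have FR : F *m R = 0.
  by rewrite mulmx_sumr big1 // => i /andP[_ il]; rewrite AA eq_sym (negPf il).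
have RE : R *m E = 0.
  by rewrite mulmx_suml big1 // => i /andP[il _]; rewrite AA (negPf il).
have RF : R *m F = 0.
  by rewrite mulmx_suml big1 // => i /andP[_ il]; rewrite AA (negPf il).
have RR : R *m R = R.
  by rewrite -[RHS]mul1mx -EFR !mulmxDl ER FR !add0r.
(* Nonzero weights are not opposite to themselves, so both weight spaces are isotropic. *)
have EOE : E^T *m Omega *m E = 0 by apply: AOA; move/eqP: ld; lia.
have FOF : F^T *m Omega *m F = 0 by apply: AOA; move/eqP: ld; lia.
have EOR : E^T *m Omega *m R = 0.
  rewrite mulmx_sumr big1 // => i /andP[_ il]; apply: AOA; rewrite -lld.
  by rewrite eqn_add2l.
have FOR : F^T *m Omega *m R = 0.
  rewrite mulmx_sumr big1 // => i /andP[il _]; apply: AOA.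
  by rewrite -lld addnC eqn_add2r.
have ROE : R^T *m Omega *m E = 0.
  rewrite linear_sum !mulmx_suml big1 // => i /andP[_ il]; apply: AOA.
  by rewrite -lld addnC eqn_add2l.
have ROF : R^T *m Omega *m F = 0.
  rewrite linear_sum !mulmx_suml big1 // => i /andP[il _]; apply: AOA.
  by rewrite -lld eqn_add2r.
have F0 : F != 0 by apply: contraNneq All; rewrite -/F => ->; rewrite mulmx0.
have Ry : R *m y = y *m R by rewrite mulmx_suml mulmx_sumr; apply: eq_bigr.
have wG t : t != 0 -> in_group Omega (weight_one E F R t).
  exact: weight_one_group.
have stab g : weight_one_torus E F R g -> in_stabilizer Omega y g.
  case=> t t0 ->{g}; have tG := wG _ (t0 ord0); split=> //.
  set g := weight_one _ _ _ _ in tG *.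
  rewrite /act; suff -> : g *m y = y *m g.
    by rewrite mulmxK //; case: tG.
  rewrite /g !mulmxDl !mulmxDr -!(scalemxAl, scalemxAr).
  by rewrite (Ay l : E *m y = _) (Ay l' : F *m y = _) Ry.
have EFR_torus := weight_one_torusP EE FF RR EF FE ER RE FR RF EFR Al F0.
have ctr := hdist _ EFR_torus stab.
apply: (weight_one_not_central EE FF EF FE RE RF Ou epsP) => // t t0.
by apply: ctr; exists (fun=> t).
Qed.
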